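(* Let $n\ge 2$, let $R_n=GR(4,n)$, and let $E\subset\mathbb F_{2^n}$ and $D\le R_n^{\ast}$ be as defined in the context, for some $\overline u\in\mathbb F_{2^n}^{\ast}$ with $\mathrm{Tr}_{\mathbb F_{2^n}}(\overline u)=0$. Let $N$ be a subgroup of $D$ and put $L=N\cap U_n$, where $U_n$ is the group of principal units of $R_n$. Then there exists an $$\bigl(N,\,L,\,K,\,2^{n}(2^{n-2}-1),\,2^{n-1}(2^{n-1}-1)-2^{n-2}\bigr)\text{-DDF},$$ where $K$ is the multiset of cardinalities of its blocks. In particular, if $N=D$, this DDF is isomorphic to (i.e. carried by a group isomorphism $D\to\mathbb Z_{2^n-1}\times\mathbb Z_2^{n-1}$ onto) a $$\bigl(\mathbb Z_{2^n-1}\times\mathbb Z_2^{n-1},\ \{0\}\times\mathbb Z_2^{n-1},\ 2^{n-1}(2^{n-1}-1),\ 2^{n}(2^{n-2}-1),\ 2^{n-1}(2^{n-1}-1)-2^{n-2}\bigr)\text{-DDF}.$$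
   Context: Divisible difference families. Let $(G,\cdot)$ be a finite abelian group with identity $1$ and $N$ a subgroup. For an indexed family $\mathcal F=\{D_i\mid 1\le i\le b\}$ of subsets (''blocks'') of $G$ with $|D_i|=k_i$, put $\theta_{\mathcal F}(d)=\sum_{i=1}^b|\{(x,y)\mid x,y\in D_i,\ x\ne y,\ xy^{-1}=d\}|$ for $d\in G$. $\mathcal F$ is a $(G,N,\{k_1,\dots,k_b\},\lambda,\mu)$-DDF (divisible difference family; $\{k_1,\dots,k_b\}$ is a multiset) if $\theta_{\mathcal F}(d)=\lambda$ for $d\in N\setminus\{1\}$ and $\theta_{\mathcal F}(d)=\mu$ for $d\in G\setminus N$. If all $k_i=k$, one writes $(G,N,k,\lambda,\mu)$-DDF. For additive groups, $xy^{-1}$ is read as $x-y$ and $1$ as $0$. Galois rings. Let $g(x)\in\mathbb Z_4[x]$ be a primitive basic irreducible polynomial of degree $n$ with root $\xi$; $R_n=GR(4,n)=\mathbb Z_4[x]/(g(x))=\mathbb Z_4[\xi]$ is the Galois ring of characteristic $4$ and extension degree $n$. Its unique maximal ideal is $P_n=2R_n$, and $R_n/P_n$ is identified with $\mathbb F_{2^n}$; $\overline a$ denotes the image of $a\in R_n$. $T_n=\{0,1,\xi,\dots,\xi^{2^n-2}\}$ is a set of representatives of $R_n/P_n$, and $T_n^{\ast}=T_n\setminus\{0\}$ is a cyclic group of order $2^n-1$. $U_n=\{1+2\beta\mid\beta\in T_n\}$ is the group of principal units. The unit group $R_n^{\ast}$ is the direct product of $T_n^{\ast}$ and $U_n$.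 The sets $E$ and $D$. Let $\mathrm{Tr}_{\mathbb F_{2^n}}$ be the absolute trace $\mathbb F_{2^n}\to\mathbb F_2$. Fix $\overline u\in\mathbb F_{2^n}^{\ast}$ with $\mathrm{Tr}_{\mathbb F_{2^n}}(\overline u)=0$ (such $\overline u$ exists exactly when $n\ge 2$). Put $E=\{\overline x\in\mathbb F_{2^n}\mid \mathrm{Tr}_{\mathbb F_{2^n}}(\overline u\,\overline x)=0\}$ and $D=\{a(1+2b)\mid a\in T_n^{\ast},\ b\in T_n,\ \overline b\in E\}$, which is a subgroup of index $2$ of $R_n^{\ast}$ isomorphic to $\mathbb Z_{2^n-1}\times\mathbb Z_2^{n-1}$. *)

(* Defs.v *)
From HB Require Import structures.
From mathcomp Require Import all_boot all_order all_algebra all_fingroup.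
From mathcomp Require Import all_solvable all_field.
From mathcomp Require Import qpoly qfpoly.

Set Implicit Arguments.
Unset Strict Implicit.
Unset Printing Implicit Defensive.

Import GRing.Theory.

(** * Divisible difference families *)

Section DDF.
Local Open Scope group_scope.
Variable gT : finGroupType.

Definition theta (b : nat) (F : 'I_b -> {set gT}) (d : gT) : nat :=
  (\sum_(i < b) #|[set p : gT * gT |
      [&& p.1 \in F i, p.2 \in F i, p.1 != p.2 & (p.1 * p.2^-1)%g == d]]|)%N.

(* The multiset of block sizes is a list [K] taken up to permutation. *)
Record is_DDF (G N : {set gT}) (K : seq nat) (lambda mu : nat)
    (b : nat) (F : 'I_b -> {set gT}) : Prop := IsDDF {
  ddf_group : group_set G;
  ddf_abelian : abelian G;
  ddf_subgroup : group_set N;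
  ddf_sub : N \subset G;
  ddf_blocks : forall i, F i \subset G;
  ddf_sizes : perm_eq [seq #|F i| | i <- enum 'I_b] K;
  ddf_in : {in N :\ 1, forall d, theta F d = lambda};
  ddf_out : {in G :\: N, forall d, theta F d = mu}
}.

End DDF.

(** * The Galois ring GR(4, n) = Z_4[x]/(g) *)

Local Open Scope ring_scope.

(* An alias of [{poly %/ g}], which the library makes a unit ring only over a
   field; here the inverse is found by search in the finite ring. *)
Definition galois_ring (g : {poly 'Z_4}) : predArgType := {poly %/ g}.

Section GaloisRingUnits.
Variable g : {poly 'Z_4}.
Local Notation R := (galois_ring g).

HB.instance Definition _ := GRing.ComNzRing.on R.
HB.instance Definition _ := Finite.on R.

Definition gr_unit : pred R := fun x => [exists y : R, y * x == 1].
Definition gr_inv (x : R) : R := odflt x [pick y : R | y * x == 1].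

Fact gr_mulVx : {in gr_unit, left_inverse 1 gr_inv *%R}.
Proof.
move=> x /existsP[y yx1]; rewrite /gr_inv; case: pickP => [z /eqP //|/(_ y)].
by rewrite yx1.
Qed.

Fact gr_unitPl (x y : R) : y * x = 1 -> gr_unit x.
Proof. by move=> yx1; apply/existsP; exists y; apply/eqP. Qed.

Fact gr_inv_out : {in [predC gr_unit], gr_inv =1 id}.
Proof.
move=> x /negP xNU; rewrite /gr_inv; case: pickP => [z /eqP zx1|//].
by case: xNU; apply: gr_unitPl zx1.
Qed.

HB.instance Definition _ :=
  GRing.ComNzRing_hasMulInverse.Build R gr_mulVx gr_unitPl gr_inv_out.

End GaloisRingUnits.

(* Reduction modulo 2, on coefficients and then on polynomials. *)
Definition red2 (c : 'Z_4) : 'F_2 := (c : nat)%:R.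
Definition redp (p : {poly 'Z_4}) : {poly 'F_2} := map_poly red2 p.

(* F_(2^n) = R_n / 2 R_n, as F_2[x]/(g mod 2): a field when g mod 2 is
   irreducible. *)
Notation residue_field g := {poly %/ redp g}.

Definition gr_bar (g : {poly 'Z_4}) (a : galois_ring g) : residue_field g :=
  in_qpoly (redp g) (redp (a : {poly %/ g})).

Definition gr_xi (g : {poly 'Z_4}) : galois_ring g := 'qX.

(* Primitivity of g mod 2 alone does not fix the order of xi, which could still
   be 2 (2^n - 1); the last clause makes the nonzero Teichmueller elements a
   cyclic group of order 2^n - 1. *)
Definition primitive_basic_irreducible (n : nat) (g : {poly 'Z_4}) : Prop :=
  [/\ g \is monic, size g = n.+1, primitive_poly (redp g)
    & gr_xi g ^+ (2 ^ n - 1) = 1].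

Section Sets.
Variables (n : nat) (g : {poly 'Z_4}).
Local Notation R := (galois_ring g).
Local Notation F := (residue_field g).

Definition teichmuller : {set R} :=
  0 |: [set gr_xi g ^+ i | i : 'I_(2 ^ n - 1)].

Definition principal_units : {set {unit R}} :=
  [set x : {unit R} | [exists b in teichmuller, val x == 1 + 2 * b]].

(* The absolute trace F_(2^n) -> F_2, with F_2 seen inside F_(2^n). *)
Definition abs_trace (x : F) : F := \sum_(i < n) x ^+ (2 ^ i).

Definition trace_zero_set (u : F) : {set F} := [set x : F | abs_trace (u * x) == 0].

Definition index2_units (u : F) : {set {unit R}} :=
  [set x : {unit R} | [exists a in teichmuller :\ 0, [exists b in teichmuller,
     (gr_bar b \in trace_zero_set u) && (val x == a * (1 + 2 * b))]]].

End Sets.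

(* Z_(2^n - 1) x Z_2^(n - 1), a finGroupType whose group law is addition;
   for n >= 2 the modulus 2^n - 1 is greater than 1. *)
Notation target_group n := ('Z_(2 ^ n - 1) * 'rV['Z_2]_(n - 1))%type.

(* {0} x Z_2^(n - 1) *)
Definition target_subgroup (n : nat) : {set target_group n} :=
  setX [set 0] [set: 'rV['Z_2]_(n - 1)].

(* Main.v *)
Require Import Defs.
From HB Require Import structures.
From mathcomp Require Import all_boot all_order all_algebra all_fingroup.
From mathcomp Require Import all_solvable all_field.
From mathcomp Require Import qpoly qfpoly zify.

Set Implicit Arguments.
Unset Strict Implicit.
Unset Printing Implicit Defensive.

Import GRing.Theory.

(** Write R for GR(4, n), F for its residue field, q = 2^n, D for the index 2
    subgroup of the units of R, and A for the set of units z of R such that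
    z + 1 lies in D.

    Let s run over representatives of the cosets of N in the unit group.  The
    blocks are the sets of those x in N for which x s lies in A: they cut A into
    its pieces along the cosets of N, each translated back into N.  For d <> 1
    in N, two elements of one block with quotient d are the same thing as a unit
    z with both z and d z in A, so theta(d) is the number of such z
    ([theta_coset_block]).  As d is in D, the condition d z + 1 in D means
    z + 1/d in D.  So everything reduces to counting the z with z <> 0 modulo 2
    such that z + 1 and z + e are in D, where e = 1/d
    ([card_kernel_minus1_shift]).

    Membership in D is the vanishing of a character.  For a unit x, the power
    x^(q-1) is congruent to 1 modulo 2, hence equal to 1 + 2b for a unique b in
    F, the principal logarithm of x; it is additive in x, and x is in D iff
    l(b) = 0, where l(b) = Tr(u b).  Moreover x + 2k has logarithm
    b + k / x, so on a residue class modulo 2 the condition x + 2k in D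
    is one affine equation over F_2 in k: l(k / x) is prescribed.

    The count can now be made residue class by residue class
    ([card_sum_slices]), the class a of z being different from 0, 1 and e.
    - If d is not a principal unit, then e <> 1 modulo 2, and the functionals
      k |-> l(k / (a + 1)) and k |-> l(k / (a + e)) are distinct and nonzero.
      Each of the q - 3 classes then contains q/4 solutions
      ([card_kernel_shifts]).
    - If d is a principal unit, then e = 1 + 2b, and both equations have the
      same linear part.  They are compatible iff l(b / (a + 1)) = 0, which is
      the case for q/2 - 2 classes, each of which contains q/2 solutions
      ([card_kernel_principal_shifts]).

    For N = D there are two blocks, and the same argument applied to the
    condition that z lies in a given coset of D and z + 1 in D gives q/4
    elements in each of the q - 2 classes a <> 0, 1
    ([card_kernel_coset_shift]).  The group D itself is the direct product of
    the cyclic group generated by xi and of the elementary abelian 2-group of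
    its principal units, which yields the isomorphism with the product of
    Z_(q-1) and Z_2^(n-1) ([kernel_isom]). *)

(** * Families of blocks cut from one set *)

Section CosetBlocks.
Local Open Scope group_scope.
Variables (gT : finGroupType) (N : {group gT}) (A : {set gT}).

Definition coset_block (i : 'I_#|rcosets N [set: gT]|) : {set gT} :=
  [set x in N | x * repr (enum_val i) \in A].

Lemma rcoset_enum_val (i : 'I_#|rcosets N [set: gT]|) :
  N :* repr (enum_val i) = enum_val i.
Proof. by have /rcosetsP[s _ ->] := enum_valP i; rewrite rcoset_repr. Qed.

Lemma card_rcoset_slice (r : gT) (P : pred gT) :
  #|[set y in N | P (y * r)]| = #|[set z in N :* r | P z]|.
Proof.
rewrite -(card_imset _ (mulIg r)); apply: eq_card => z; rewrite inE.
apply/imsetP/andP=> [[y + ->]|[/rcosetP[y Ny ->] Pz]].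
  by rewrite inE => /andP[Ny Py]; rewrite mem_rcoset mulgK.
by exists y; rewrite // inE Ny.
Qed.

(** Within the block of a coset C, a pair of quotient d is (d y, y), and
    y |-> y * repr C identifies such y with the z in C for which z and d z are
    in A.  The cosets partition the group, so summing over them removes every
    trace of N from the count. *)
Lemma theta_coset_block (d : gT) : d \in N -> d != 1 ->
  theta coset_block d = #|[set z in A | d * z \in A]|.
Proof.
move=> Nd d1.
have blockE i : #|[set p : gT * gT | [&& p.1 \in coset_block i,
    p.2 \in coset_block i, p.1 != p.2 & p.1 * p.2^-1 == d]]|
  = #|[set z in enum_val i | (z \in A) && (d * z \in A)]|.
  rewrite -[in RHS](rcoset_enum_val i).
  rewrite -(card_rcoset_slice _ [pred z | (z \in A) && (d * z \in A)]).
  have pair_inj : injective (fun y : gT => (d * y, y)) by move=> ? ? [].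
  rewrite -(card_imset _ pair_inj).
  apply: eq_card => -[x y]; rewrite !inE /=; apply/idP/imsetP.
    case/and4P=> /andP[Nx Ax] /andP[Ny Ay] _ /eqP <-.
    by exists y; rewrite ?mulgKV // inE Ny Ay /= mulgA mulgKV Ax.
  case=> y'; rewrite inE => /and3P[Ny Ay Ady] [-> ->].
  rewrite Ny Ay mulgK eqxx groupM // -mulgA Ady /= andbT.
  apply: contra d1 => /eqP/(congr1 (mulg^~ y'^-1)).
  by rewrite mulgK mulgV => ->.
rewrite /theta (eq_bigr _ (fun i _ => blockE i)).
rewrite -(big_enum_val (fun C : {set gT} =>
  #|[set z in C | (z \in A) && (d * z \in A)]|)) /= -sum1_card.
rewrite (partition_big (fun z => N :* z) (mem (rcosets N [set: gT]))) /=.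
  apply: eq_bigr => C /rcosetsP[s _ ->].
  rewrite -sum1_card; apply: eq_bigl => z; rewrite !inE andbC; congr (_ && _).
  by apply/idP/eqP=> [/rcoset_eqP //|<-]; apply: rcoset_refl.
by move=> z _; rewrite mem_rcosets (subsetP (mulG_subr _ _)) ?inE.
Qed.

End CosetBlocks.

(** * Level sets of F_2-valued functionals *)

Section CountingFunctionals.
Local Open Scope ring_scope.
Variable V : finZmodType.
Implicit Types (l : V -> bool) (c : bool).

(** Translation by a vector where l does not vanish exchanges the two level
    sets. *)
Lemma card_functional l c : {morph l : x y / x + y >-> x (+) y} ->
  (exists v, l v) -> (2 * #|[set v | l v == c]| = #|V|)%N.
Proof.
move=> lD [v0 lv0].
rewrite -cardsT -(cardsID [set v | l v == c] setT) setTI mul2n -addnn.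
congr (_ + _)%N; rewrite -(card_imset _ (addIr v0)); apply: eq_card => v.
rewrite !inE; apply/imsetP/idP=> [[w + ->]|lv].
  by rewrite inE lD lv0 => /eqP->; case: c.
exists (v - v0); last by rewrite subrK.
rewrite inE; have := lD (v - v0) v0; rewrite subrK lv0 => lv'.
by move: lv; rewrite lv'; case: (l _); case: c.
Qed.

(** The functionals l1, l2 and l1 + l2 are all nonzero, so the set where l1 = c1,
    the set where l2 = c2 and the set where exactly one of these holds all have
    #|V| / 2 elements; this determines the size of the intersection of the first
    two. *)
Lemma card_functional2 l1 l2 c1 c2 :
    {morph l1 : x y / x + y >-> x (+) y} ->
    {morph l2 : x y / x + y >-> x (+) y} ->
    (exists v, l1 v) -> (exists v, l2 v) -> (exists v, l1 v (+) l2 v) ->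
  (4 * #|[set v | (l1 v == c1) && (l2 v == c2)]| = #|V|)%N.
Proof.
move=> l1D l2D l1n l2n l12n.
have l12D : {morph (fun v => l1 v (+) l2 v) : x y / x + y >-> x (+) y}.
  by move=> x y; rewrite l1D l2D addbACA.
have xorE b1 b2 : (b1 (+) b2 == ~~ (c1 (+) c2)) = (b1 == c1) (+) (b2 == c2).
  by case: b1; case: b2; case: c1; case: c2.
have := card_functional (~~ (c1 (+) c2)) l12D l12n.
have := card_functional c1 l1D l1n; have := card_functional c2 l2D l2n.
set A1 := [set v | l2 v == c2]; set A2 := [set v | l1 v == c1].
set A12 := [set v | _ == _]; set A := [set v | _ && _].
have -> : A = A1 :&: A2 by apply/setP=> v; rewrite !inE andbC.
have -> : A12 = (A1 :\: A2) :|: (A2 :\: A1).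
  apply/setP=> v; rewrite !inE xorE.
  by case: (l1 v == c1); case: (l2 v == c2).
rewrite cardsU (_ : _ :&: _ = set0) ?cards0; last first.
  by apply/setP=> v; rewrite !inE; case: (l1 v == c1); case: (l2 v == c2).
by have := cardsID A2 A1; have := cardsID A1 A2; rewrite [A2 :&: A1]setIC; lia.
Qed.

End CountingFunctionals.

(** * Transport of difference families *)

Section Transport.
Local Open Scope group_scope.
Variables (aT rT : finGroupType) (G : {group aT}) (phi : {morphism G >-> rT}).
Hypothesis injphi : 'injm phi.

Lemma theta_injm b (F : 'I_b -> {set aT}) d :
  (forall i, F i \subset G) -> d \in G ->
  theta (fun i => phi @: F i) (phi d) = theta F d.
Proof.
move=> sFG Gd; apply: eq_bigr => i _; have sF := subsetP (sFG i).
pose phi2 (p : aT * aT) := (phi p.1, phi p.2).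
have phi_inj := injmP injphi.
rewrite -[RHS](@card_in_imset _ _ phi2).
  apply: eq_card => -[x' y']; rewrite !inE /=; apply/and4P/imsetP.
    case=> /imsetP[x Fx ->] /imsetP[y Fy ->] xy /eqP dxy.
    exists (x, y) => //; rewrite inE /= Fx Fy /=; apply/andP; split.
      by apply: contra xy => /eqP->.
    apply/eqP/phi_inj => //; first by rewrite groupM ?groupV ?sF.
    by rewrite morphM ?groupV ?sF // morphV ?sF.
  case=> -[x y]; rewrite inE /= => /and4P[Fx Fy xy /eqP <-] [-> ->].
  split; rewrite ?imset_f //.
    by apply: contra xy => /eqP xy; apply/eqP/phi_inj => //; apply: sF.
  by rewrite morphM ?groupV ?sF // morphV ?sF.
move=> [x y] [x' y']; rewrite !inE /= => /and4P[Fx Fy _ _] /and4P[Fx' Fy' _ _].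
by case=> xx' yy'; congr (_, _); apply: phi_inj => //; apply: sF.
Qed.

Lemma DDF_injm (N : {set aT}) (K : seq nat) lambda mu b (F : 'I_b -> {set aT}) :
  is_DDF G N K lambda mu F ->
  is_DDF (phi @: G) (phi @: N) K lambda mu (fun i => phi @: F i).
Proof.
case=> _ abG gN sNG sFG szF thin thout.
have NE : phi @: N = phi @* Group gN by rewrite morphimEsub.
have GE : phi @: G = phi @* G by rewrite morphimEdom.
have phi_inj := injmP injphi.
split.
- by rewrite GE groupP.
- by rewrite GE morphim_abelian.
- by rewrite NE groupP.
- exact: imsetS.
- by move=> i; apply: imsetS.
- rewrite (eq_map (g := fun i => #|F i|)) // => i.
  apply: card_in_imset; apply: sub_in2 phi_inj => x.
  exact: (subsetP (sFG i)).
- move=> d' /setD1P[d'1 /imsetP[d Nd d'E]]; have Gd := subsetP sNG d Nd.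
  rewrite d'E theta_injm //; apply: thin; rewrite !inE Nd andbT.
  by apply: contra d'1 => /eqP d1; rewrite d'E d1 morph1.
- move=> d' /setDP[/imsetP[d Gd ->] phiNd]; rewrite theta_injm //; apply: thout.
  by rewrite inE Gd andbT; apply: contra phiNd; apply: imset_f.
Qed.

End Transport.

(** * The trace of a finite field of characteristic 2 *)

Section BinaryTrace.
Local Open Scope ring_scope.
Variables (n : nat) (K : finFieldType).
Hypotheses (n_gt0 : (0 < n)%N) (cardK : #|K| = (2 ^ n)%N).

Definition frobenius_sum (x : K) : K := \sum_(i < n) x ^+ (2 ^ i).
Local Notation tr := frobenius_sum.

Lemma pchar2_of_card : 2 \in [pchar K].
Proof. exact: card_finPcharP cardK isT. Qed.

Lemma trace_additive : {morph tr : x y / x + y}.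
Proof.
move=> x y; rewrite /frobenius_sum -big_split; apply: eq_bigr => i _ /=.
apply: exprDn_pchar; rewrite pnatX; apply/orP; left.
by rewrite pnatE // pchar2_of_card.
Qed.

Lemma trace_idem x : tr x ^+ 2 = tr x.
Proof.
rewrite /frobenius_sum -(pFrobenius_autE pchar2_of_card) rmorph_sum /=.
case: n n_gt0 cardK => // m _ cardKm.
rewrite big_ord_recr big_ord_recl /= addrC; congr (_ + _).
  by rewrite pFrobenius_autE -exprM -expnSr -cardKm expf_card expr1.
by apply: eq_bigr => i _; rewrite pFrobenius_autE -exprM -expnSr.
Qed.

(** The trace takes its values in the prime field {0, 1}, by [trace_idem], and
    there being nonzero is the same as being 1.  So the boolean encodes the
    F_2-valued trace, with exclusive or as addition. *)
Lemma trace_neq0D x y : (tr (x + y) != 0) = (tr x != 0) (+) (tr y != 0).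
Proof.
have tr01 z : (tr z == 0) || (tr z == 1).
  by rewrite -[_ == 1]subr_eq0 -mulf_eq0 mulrBr mulr1 -expr2 trace_idem subrr.
rewrite trace_additive.
case/orP: (tr01 x) => /eqP->; case/orP: (tr01 y) => /eqP->;
  rewrite ?(addr0, add0r, eqxx, oner_eq0) //.
by rewrite (addrr_pchar2 pchar2_of_card) eqxx.
Qed.

(** The trace is a polynomial function of degree 2^(n-1), so it has fewer zeros
    than the field has elements. *)
Lemma trace_nonzero : exists x, tr x != 0.
Proof.
have [x trx | /= tr0] := pickP (fun x => tr x != 0); first by exists x.
pose p : {poly K} := \sum_(i < n) 'X^(2 ^ i).
have sz_p : (size p <= (2 ^ n.-1).+1)%N.
  apply: leq_trans (size_sum _ _ _) _; apply/bigmax_leqP => i _.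
  by rewrite size_polyXn ltnS leq_pexp2l // -ltnS prednK.
have p_neq0 : p != 0.
  apply/eqP => /(congr1 (fun q : {poly K} => q`_1)).
  rewrite coef_sum coef0 (bigD1 (Ordinal n_gt0)) //= big1 => [|i i0].
    by rewrite addr0 expn0 coefX => /eqP; rewrite oner_eq0.
  (* the coefficient of X comes from the term of index 0 alone *)
  rewrite coefXn -[1%N](expn0 2) eqn_exp2l // eq_sym.
  by rewrite -val_eqE /= in i0; rewrite (negPf i0).
have roots_p : all (root p) (enum K).
  apply/allP => x _; rewrite rootE horner_sum; move/negbFE: (tr0 x).
  rewrite /frobenius_sum => /eqP tr_x; rewrite -[X in _ == X]tr_x; apply/eqP.
  by apply: eq_bigr => i _; rewrite hornerXn.
have := max_poly_roots p_neq0 roots_p (enum_uniq _).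
rewrite -cardE cardK => /leq_trans/(_ sz_p); rewrite ltnS leq_exp2l //.
by rewrite leqNgt prednK // leqnn.
Qed.

End BinaryTrace.

(** * The group Z_(2^n - 1) x Z_2^(n - 1) *)

Section Target.
Variable n : nat.
Hypothesis n_gt1 : 2 <= n.

Lemma target_modulus_gt1 : 1 < 2 ^ n - 1.
Proof.
by rewrite -(subnK n_gt1) addn2 !expnS; have := expn_gt0 2 (n - 2); lia.
Qed.

Lemma card_target_cyclic :
  #|setX [set: 'Z_(2 ^ n - 1)] [1 'rV['Z_2]_(n - 1)]%g| = 2 ^ n - 1.
Proof.
by rewrite cardsX cards1 muln1 cardsT card_ord Zp_cast ?target_modulus_gt1.
Qed.

Lemma card_target_subgroup : #|target_subgroup n| = 2 ^ (n - 1).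
Proof. by rewrite cardsX cards1 mul1n cardsT card_mx card_ord mul1n. Qed.

Lemma cyclic_target :
  cyclic (setX [set: 'Z_(2 ^ n - 1)] [1 'rV['Z_2]_(n - 1)]%g).
Proof.
rewrite -morphim_pairg1 morphim_cyclic //.
by apply/cyclicP; exists Zp1; apply: Zp_cycle.
Qed.

Lemma abelem_target_subgroup : (2.-abelem (target_subgroup n))%g.
Proof.
apply/(@abelemP _ 2 (setX_group 1 [set: 'rV['Z_2]_(n - 1)])%G) => //; split.
  apply/centsP=> -[a b] _ [a' b'] _; congr (_, _).
    exact: (@addrC 'Z_(2 ^ n - 1)).
  exact: (@addrC 'rV['Z_2]_(n - 1)).
move=> [a b]; rewrite in_setX => /andP[/set1P /= -> _]; congr (_, _) => //.
  by rewrite /= mulg1.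
apply/matrixP=> i j; rewrite !mxE.
by move: (b i j); apply/eqfunP; rewrite /= ; apply/forallP=> [[[|[|]]]].
Qed.

(** As 2^n - 1 is odd, the first coordinate of an element of square 1 is
    trivial. *)
Lemma mem_target_subgroup (x : target_group n) :
  (x ^+ 2 = 1)%g -> x \in target_subgroup n.
Proof.
case: x => a b x2; rewrite !inE /= andbT -[a == _]order_eq1 -dvdn1.
have odd_m : coprime 2 (2 ^ n - 1).
  by rewrite coprime2n oddB ?expn_gt0 // oddX orbF eqn0Ngt ltnW.
suff: #[a]%g %| gcdn 2 (2 ^ n - 1) by rewrite (eqP odd_m).
rewrite dvdn_gcd order_dvdn; apply/andP; split; first exact/eqP/(congr1 fst x2).
apply: dvdn_trans (@order_dvdG _ [set: _]%G a (in_setT a)) _.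
by rewrite cardsT card_ord Zp_cast ?target_modulus_gt1.
Qed.

Lemma target_dprod :
  (setX [set: 'Z_(2 ^ n - 1)] 1 \x target_subgroup n = [set: target_group n])%g.
Proof.
rewrite [LHS](setX_dprod [set: _]%G [set: _]%G).
by apply/setP=> x; rewrite !inE.
Qed.

End Target.

(** * Rings of characteristic 4 over a field of characteristic 2 *)

(** What is used of a Galois ring of characteristic 4: the kernel of the
    reduction and the annihilator of 2 are both the ideal of multiples of 2.
    Hence there is an exact sequence of R-modules 0 -> K -> R -> K -> 0, whose
    first map is the multiplication by 2. *)
Record galois_reduction (R : finComUnitRingType) (K : finFieldType)
    (bar : {rmorphism R -> K}) : Prop := GaloisReduction {
  bar_surj : forall k : K, exists x : R, bar x = k;
  bar_eq0P : forall x : R, bar x = 0%R -> exists y : R, x = (y *+ 2)%R;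
  mulr2n_eq0P : forall x : R, (x *+ 2 = 0)%R <-> bar x = 0%R
}.

Section Reduction.
Local Open Scope ring_scope.
Variables (R : finComUnitRingType) (K : finFieldType) (bar : {rmorphism R -> K}).
Hypothesis barR : galois_reduction bar.
Variable n : nat.
Hypotheses (n_gt1 : (2 <= n)%N) (cardK : #|K| = (2 ^ n)%N).

Let n_gt0 : (0 < n)%N := ltnW n_gt1.

Definition bar_lift (k : K) : R := odflt 0 [pick x | bar x == k].

Lemma bar_liftK : cancel bar_lift bar.
Proof.
move=> k; rewrite /bar_lift; case: pickP => [x /eqP //|no_lift].
by have [x xk] := bar_surj barR k; have := no_lift x; rewrite xk eqxx.
Qed.

(** The map K -> R that the multiplication by 2 of R induces; it is the first
    map of the exact sequence, and it does not depend on the chosen lift, by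
    [twice_bar]. *)
Definition twice (k : K) : R := bar_lift k *+ 2.

Lemma twice_bar x : twice (bar x) = x *+ 2.
Proof.
apply/eqP; rewrite -subr_eq0 /twice -mulrnBl; apply/eqP.
by apply/(mulr2n_eq0P barR); rewrite rmorphB /= bar_liftK subrr.
Qed.

Lemma twiceD : {morph twice : k k' / k + k'}.
Proof.
move=> k k'; rewrite -[k]bar_liftK -[k']bar_liftK -rmorphD.
by rewrite !twice_bar mulrnDl.
Qed.

Lemma twice0 : twice 0 = 0.
Proof. by rewrite -(rmorph0 bar) twice_bar mul0rn. Qed.

Lemma bar_twice k : bar (twice k) = 0.
Proof.
rewrite rmorphMn /= bar_liftK -mulr_natr.
by rewrite (pcharf0 (pchar2_of_card cardK)) mulr0.
Qed.

Lemma bar_1twice k : bar (1 + twice k) = 1.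
Proof. by rewrite rmorphD rmorph1 /= bar_twice addr0. Qed.
Lemma twice_inj : injective twice.
Proof.
move=> k k' kk'; apply/eqP; rewrite -subr_eq0; apply/eqP.
rewrite -[k]bar_liftK -[k']bar_liftK -rmorphB; apply/(mulr2n_eq0P barR).
by rewrite mulrnBl -/(twice k) -/(twice k') kk' subrr.
Qed.

Lemma mul_twice x k : x * twice k = twice (bar x * k).
Proof. by rewrite -{2}[k]bar_liftK -rmorphM twice_bar -mulrnAr. Qed.

Lemma bar_eqP x y : bar x = bar y -> exists k, x = y + twice k.
Proof.
move=> xy; have [|z xyz] := @bar_eq0P _ _ _ barR (x - y).
  by rewrite rmorphB /= xy subrr.
by exists (bar z); rewrite twice_bar -xyz addrC subrK.
Qed.

Lemma sqr_1twice k : (1 + twice k) ^+ 2 = 1.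
Proof.
rewrite sqrrD expr1n mul1r expr2 mul_twice bar_twice mul0r twice0 addr0.
by rewrite -twice_bar bar_twice twice0 addr0.
Qed.

(** If y lifts the inverse of the reduction of x, then x y is a principal unit
    1 + 2k, which is its own inverse. *)
Lemma unit_bar x : (x \is a GRing.unit) = (bar x != 0).
Proof.
apply/idP/idP=> [Ux|x0]; first by rewrite -unitfE rmorph_unit.
have [y xy] := bar_surj barR (bar x)^-1.
have [|k xyk] := @bar_eqP (x * y) 1.
  by rewrite rmorphM rmorph1 /= xy mulfV.
apply/unitrPr; exists (y * (1 + twice k)).
by rewrite mulrA xyk -expr2 sqr_1twice.
Qed.

(** Every element is uniquely a lift of its residue class a plus some 2k, so a
    set can be counted one residue class at a time. *)
Lemma card_slices (P : pred R) :
  #|[set z | P z]| = (\sum_(a : K) #|[set k | P (bar_lift a + twice k)%R]|)%N.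
Proof.
rewrite -sum1_card (partition_big bar predT) //=; apply: eq_bigr => a _.
have inj : injective (fun k : K => bar_lift a + twice k).
  by move=> k k' /addrI/twice_inj.
rewrite sum1_card -(card_imset _ inj); apply: eq_card => z.
rewrite unfold_in /= inE; apply/andP/imsetP=> [[Pz /eqP za]|[k + ->]].
  have [|k zk] := @bar_eqP z (bar_lift a); first by rewrite bar_liftK.
  by exists k; rewrite // inE -zk.
by rewrite inE => ->; rewrite rmorphD /= bar_liftK bar_twice addr0.
Qed.

(** ** The principal logarithm *)

(** For a unit x = a (1 + 2b) with a of order dividing q - 1, this is b: the odd
    power q - 1 kills a and fixes 1 + 2b, whose square is 1.  Reading b off a
    power of x makes additivity evident, and no choice of a is involved. *)
Definition principal_log (x : R) : K :=
  odflt 0 [pick k | x ^+ (2 ^ n - 1) == 1 + twice k].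

Lemma principal_logP x :
  bar x != 0 -> x ^+ (2 ^ n - 1) = 1 + twice (principal_log x).
Proof.
move=> x0; rewrite /principal_log; case: pickP => [k /eqP //|no_log].
have [|k xk] := @bar_eqP (x ^+ (2 ^ n - 1)) 1; last first.
  by have := no_log k; rewrite xk eqxx.
rewrite rmorphXn rmorph1 /=; apply: (mulfI x0).
by rewrite mulr1 -exprS subn1 prednK ?expn_gt0 // -cardK expf_card.
Qed.

Lemma principal_log_eq x k :
  bar x != 0 -> x ^+ (2 ^ n - 1) = 1 + twice k -> principal_log x = k.
Proof. by move=> /principal_logP -> /addrI/twice_inj. Qed.

Lemma exp_1twice k m : (1 + twice k) ^+ m = 1 + twice (k *+ m).
Proof.
elim: m => [|m IHm]; first by rewrite mulr0n twice0 addr0.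
rewrite exprSr IHm mulrS twiceD mulrDl mul1r mulrDr mulr1 mul_twice.
by rewrite bar_twice mul0r twice0 addr0 -addrA.
Qed.

Lemma principal_log_1twice k : principal_log (1 + twice k) = k.
Proof.
apply: principal_log_eq; first by rewrite bar_1twice oner_eq0.
rewrite exp_1twice; congr (1 + twice _).
(* k *+ (q - 1) = k because q k = 0 and k = - k *)
apply: (addIr k); rewrite -mulrSr subn1 prednK ?expn_gt0 //.
have char2 := pchar2_of_card cardK.
rewrite (addrr_pchar2 char2) -(prednK n_gt0) expnS mulrnA.
by rewrite mulr2n (addrr_pchar2 char2) mul0rn.
Qed.

Lemma principal_logM x y : bar x != 0 -> bar y != 0 ->
  principal_log (x * y) = principal_log x + principal_log y.
Proof.
move=> x0 y0; apply: principal_log_eq; first by rewrite rmorphM /= mulf_neq0.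
rewrite exprMn !principal_logP // mulrDl mul1r mulrDr mulr1 mul_twice bar_twice.
by rewrite mul0r twice0 addr0 -addrA -twiceD [principal_log y + _]addrC.
Qed.

(** Indeed x + 2k = x (1 + 2k/x): within a residue class the logarithm is an
    affine function. *)
Lemma principal_logD x k : bar x != 0 ->
  principal_log (x + twice k) = principal_log x + k / bar x.
Proof.
move=> x0; have -> : x + twice k = x * (1 + twice (k / bar x)).
  by rewrite mulrDr mulr1 mul_twice mulrCA mulfV ?mulr1.
by rewrite principal_logM ?principal_log_1twice // bar_1twice oner_neq0.
Qed.

Lemma principal_log_root x : x ^+ (2 ^ n - 1) = 1 -> principal_log x = 0.
Proof.
move=> x1; apply: principal_log_eq; last by rewrite twice0 addr0.
rewrite -unit_bar -(@unitrX_pos _ x (2 ^ n - 1)) ?x1 ?unitr1 // subn_gt0.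
by rewrite -[1%N](expn0 2) ltn_exp2l.
Qed.

(** ** The kernel of a functional of the logarithm *)

Variable l : K -> bool.
Hypothesis lD : {morph l : x y / x + y >-> x (+) y}.
Hypothesis l_nonzero : exists k, l k.

Lemma functional0 : l 0 = false.
Proof. by have := lD 0 0; rewrite addr0 addbb. Qed.

Definition in_kernel (x : R) : bool := (bar x != 0) && ~~ l (principal_log x).

Lemma in_kernelM x y :
  in_kernel x -> bar y != 0 -> in_kernel (x * y) = in_kernel y.
Proof.
case/andP=> x0 lx y0; rewrite /in_kernel rmorphM mulf_eq0.
by rewrite (negPf x0) (negPf y0) /= principal_logM // lD (negPf lx).
Qed.

Lemma l_mul_morph c : {morph (fun k => l (k / c)) : x y / x + y >-> x (+) y}.
Proof. by move=> x y; rewrite mulrDl lD. Qed.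

Lemma l_mul_nonzero c : c != 0 -> exists k, l (k / c).
Proof. by move=> c0; have [k lk] := l_nonzero; exists (k * c); rewrite mulfK. Qed.

Lemma addb_eq (b1 b2 b3 : bool) : (b1 (+) b2 == b3) = (b2 == b1 (+) b3).
Proof. by move: b1 b2 b3 => [] [] []. Qed.

Lemma card_slice1 x c : bar x != 0 ->
  (2 * #|[set k | l (principal_log (x + twice k)%R) == c]| = 2 ^ n)%N.
Proof.
move=> x0; rewrite -cardK -(card_functional (l (principal_log x) (+) c)
  (l_mul_morph (bar x)) (l_mul_nonzero x0)).
congr (2 * _)%N; apply: eq_card => k; rewrite !inE principal_logD // lD.
by rewrite addb_eq.
Qed.

(** The two conditions prescribe the functionals l(k / x) and l(k / y), which are
    nonzero, and distinct because 1 / x and 1 / y are. *)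
Lemma card_slice2 x y c c' : bar x != 0 -> bar y != 0 -> bar x != bar y ->
  (4 * #|[set k | (l (principal_log (x + twice k)%R) == c)
               && (l (principal_log (y + twice k)%R) == c')]| = 2 ^ n)%N.
Proof.
move=> x0 y0 xy; rewrite -cardK.
rewrite -(@card_functional2 _ _ _
  (l (principal_log x) (+) c) (l (principal_log y) (+) c')
  (l_mul_morph (bar x)) (l_mul_morph (bar y))
  (l_mul_nonzero x0) (l_mul_nonzero y0)).
  congr (4 * _)%N; apply: eq_card => k; rewrite !inE !principal_logD // !lD.
  by rewrite !addb_eq.
have xy0 : (bar x)^-1 + (bar y)^-1 != 0.
  by rewrite addr_eq0 (oppr_pchar2 (pchar2_of_card cardK)) (inj_eq invr_inj).
have [k lk] := l_nonzero; exists (k / ((bar x)^-1 + (bar y)^-1)).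
by rewrite -lD -mulrDr divfK.
Qed.

Lemma card_sum_slices (S : {set K}) (m c : nat) (P : pred R) :
    (forall a, a \in S -> c * #|[set k | P (bar_lift a + twice k)%R]| = m)%N ->
    (forall a k, a \notin S -> P (bar_lift a + twice k)%R = false) ->
  (c * #|[set z | P z]| = #|S| * m)%N.
Proof.
move=> slice_in slice_out.
rewrite card_slices big_distrr /= (bigID (mem S)) /=.
rewrite [X in (_ + X)%N]big1 ?addn0.
  by rewrite (eq_bigr (fun=> m)) // sum_nat_const.
move=> a Sa; apply/eqP; rewrite muln_eq0 cards_eq0 orbC; apply/orP; left.
by apply/eqP/setP=> k; rewrite !inE slice_out.
Qed.

Lemma bar_lift_twice a k : bar (bar_lift a + twice k) = a.
Proof. by rewrite rmorphD /= bar_liftK bar_twice addr0. Qed.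

Lemma addr_neq0_pchar2 (a b : K) : (a + b != 0) = (a != b).
Proof. by rewrite addr_eq0 (oppr_pchar2 (pchar2_of_card cardK)). Qed.

Lemma in_kernel_lift a x k : in_kernel (bar_lift a + twice k + x)
  = (a != bar x) && (l (principal_log (bar_lift a + x + twice k)) == false).
Proof.
rewrite /in_kernel addrAC rmorphD /= bar_twice addr0 rmorphD /= bar_liftK.
by rewrite addr_neq0_pchar2 eqbF_neg.
Qed.

(** ** Counting the shifts *)

(** The residue classes excluded are those of 0, of 1 and of e, where one of z,
    z + 1 and z + e is not a unit; the others contain q/4 solutions each, by
    [card_slice2]. *)
Lemma card_kernel_shifts e : bar e != 0 -> bar e != 1 ->
  (4 * #|[set z | [&& bar z != 0, in_kernel (z + 1) & in_kernel (z + e)]%R]|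
   = (2 ^ n - 3) * 2 ^ n)%N.
Proof.
move=> e0 e1.
rewrite (@card_sum_slices (~: [set 0; 1; bar e]) (2 ^ n)).
- rewrite cardsCs setCK cardK -setUA cardsU1 !inE cards2 ![_ == bar e]eq_sym.
  by rewrite (negPf e0) (negPf e1) eq_sym oner_eq0.
- move=> a; rewrite !inE !negb_or -andbA => /and3P[a0 a1 ae].
  rewrite -(@card_slice2 (bar_lift a + 1) (bar_lift a + e) false false).
  + congr (4 * _)%N; apply: eq_card => k; rewrite !inE bar_lift_twice a0 /=.
    by rewrite !in_kernel_lift rmorph1 a1 ae.
  + by rewrite rmorphD rmorph1 /= bar_liftK addr_neq0_pchar2.
  + by rewrite rmorphD /= bar_liftK addr_neq0_pchar2.
  + by rewrite !rmorphD rmorph1 /= (inj_eq (addrI _)) eq_sym.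
- move=> a k; rewrite !inE negbK bar_lift_twice !in_kernel_lift rmorph1.
  by case/orP=> [/orP[]|] /eqP->; rewrite eqxx ?andbF.
Qed.

(** This gives the sizes of the blocks when the cosets are those of the kernel
    itself: prescribing the logarithm of z up to the kernel of l fixes a
    coset. *)
Lemma card_kernel_coset_shift c :
  (4 * #|[set z | [&& bar z != 0, l (principal_log z) == c
                    & in_kernel (z + 1)]%R]|
   = (2 ^ n - 2) * 2 ^ n)%N.
Proof.
rewrite (@card_sum_slices (~: [set 0; 1]) (2 ^ n)).
- by rewrite cardsCs setCK cardK cards2 eq_sym oner_eq0.
- move=> a; rewrite !inE !negb_or => /andP[a0 a1].
  rewrite -(@card_slice2 (bar_lift a) (bar_lift a + 1) c false).
  + congr (4 * _)%N; apply: eq_card => k; rewrite !inE bar_lift_twice a0 /=.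
    by rewrite !in_kernel_lift rmorph1 a1.
  + by rewrite bar_liftK.
  + by rewrite rmorphD rmorph1 /= bar_liftK addr_neq0_pchar2.
  + rewrite !rmorphD rmorph1 /= -[X in X != _]addr0 (inj_eq (addrI _)).
    by rewrite eq_sym oner_eq0.
- move=> a k; rewrite !inE negbK bar_lift_twice !in_kernel_lift rmorph1.
  by case/orP=> /eqP->; rewrite eqxx ?andbF.
Qed.

(** In the class a, the elements z + 1 and z + 1 + 2b have logarithms that differ
    by the constant b / (a + 1).  So the two conditions are equivalent if
    l(b / (a + 1)) = 0, and contradictory otherwise. *)
Lemma card_kernel_principal_shifts (b : K) : b != 0 -> ~~ l b ->
  (4 * #|[set z | [&& bar z != 0, in_kernel (z + 1)
                    & in_kernel (z + (1 + twice b))]%R]|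
   = (2 ^ n - 4) * 2 ^ n)%N.
Proof.
move=> b0 lb.
pose S : {set K} := [set a : K | [&& a != 0, a != 1 & ~~ l (b / (a + 1))]].
have cardS : (2 * #|S| = 2 ^ n - 4)%N.
  (* a |-> b / (a + 1) is a bijection of K, as 1 / 0 = 0; it sends 1 to 0 and
     0 to b, and these two values are in the kernel of l *)
  pose Z := [set t | l t == false].
  have cardZ : (2 * #|Z| = 2 ^ n)%N by rewrite (card_functional _ lD) // cardK.
  have inj : injective (fun a : K => b / (a + 1)).
    by move=> a a' /(mulfI b0)/invr_inj/addIr.
  have -> : S = (fun a => b / (a + 1)) @^-1: (Z :\ 0 :\ b).
    have divb_eqb a : (b / (a + 1) == b) = (a == 0).
      rewrite -[X in _ == X]mulr1 (inj_eq (mulfI b0)) -[X in _ == X]invr1.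
      by rewrite (inj_eq invr_inj) -[X in _ == X]add0r (inj_eq (addIr 1)).
    have divb_eq0 a : (b / (a + 1) == 0) = (a == 1).
      rewrite mulf_eq0 (negPf b0) invr_eq0; apply: negb_inj.
      by rewrite addr_neq0_pchar2.
    by apply/setP=> a; rewrite !inE eqbF_neg divb_eqb divb_eq0.
  rewrite card_preimset // -cardZ (cardsD1 0 Z) (cardsD1 b (Z :\ 0)) !inE.
  by rewrite b0 functional0 (negPf lb) /=; lia.
have bar_shift a : bar (bar_lift a + 1) = a + 1.
  by rewrite rmorphD rmorph1 /= bar_liftK.
have l_shift a k : a != 1 ->
    l (principal_log (bar_lift a + (1 + twice b) + twice k))
    = l (principal_log (bar_lift a + 1 + twice k)) (+) l (b / (a + 1)).
  move=> a1; rewrite (addrA (bar_lift a) 1) (addrAC _ (twice b)).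
  by rewrite principal_logD;
    rewrite rmorphD /= bar_twice addr0 bar_shift ?addr_neq0_pchar2.
rewrite (@card_sum_slices S (2 * 2 ^ n)).
- by rewrite mulnA -cardS [(#|S| * 2)%N]mulnC.
- move=> a; rewrite inE => /and3P[a0 a1 la].
  rewrite -(@card_slice1 (bar_lift a + 1) false) ?bar_shift ?addr_neq0_pchar2 //.
  rewrite mulnA; congr (4 * _)%N; apply: eq_card => k.
  rewrite !inE bar_lift_twice a0 /=.
  rewrite !in_kernel_lift l_shift // rmorphD rmorph1 /= bar_twice addr0 a1 /=.
  by rewrite (negPf la) addbF andbb.
- move=> a k; rewrite inE bar_lift_twice !in_kernel_lift.
  rewrite rmorphD rmorph1 /= bar_twice addr0.
  case: eqP => //= _; case: (altP (a =P 1)) => //= a1; rewrite negbK => la.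
  by rewrite l_shift // la addbT; case: (l _).
Qed.

(** ** Subgroups of the unit group *)

Lemma bar_unit (x : {unit R}) : bar (val x) != 0.
Proof. by rewrite -unit_bar; apply: valP. Qed.

Lemma mul_unitC (x y : {unit R}) : (x * y = y * x)%g.
Proof. by apply: val_inj; rewrite /= mulrC. Qed.

Lemma card_unit_set (P : pred R) :
  #|[set z : {unit R} | P (val z)]| = #|[set z | (bar z != 0) && P z]|.
Proof.
rewrite -(card_imset _ val_inj); apply: eq_card => z; rewrite inE.
apply/imsetP/andP=> [[x + ->]|[z0 Pz]]; first by rewrite inE bar_unit.
rewrite -unit_bar in z0.
by exists (FinRing.unit R z0); rewrite ?inE.
Qed.

Definition principal : {set {unit R}} := [set x | bar (val x) == 1].
Definition kernel_units : {set {unit R}} := [set x | in_kernel (val x)].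

Lemma principal_group_set : group_set principal.
Proof.
apply/group_setP; split=> [|x y]; rewrite !inE ?rmorph1 //= => /eqP x1 /eqP y1.
by rewrite rmorphM /= x1 y1 mulr1.
Qed.
Canonical principal_group := Group principal_group_set.

Lemma principal_twice x : x \in principal -> exists k, val x = 1 + twice k.
Proof. by rewrite inE => /eqP x1; apply: bar_eqP; rewrite x1 rmorph1. Qed.

Lemma principal_sqr x : x \in principal -> (x ^+ 2 = 1)%g.
Proof.
move=> /principal_twice[k xk]; apply: val_inj.
by rewrite FinRing.val_unitX /= xk sqr_1twice.
Qed.

Lemma kernel_coset (z r : {unit R}) :
  (z * r^-1 \in kernel_units)%g
  = (l (principal_log (val z)) == l (principal_log (val r))).
Proof.
have := principal_logM (bar_unit (z * r^-1)%g) (bar_unit r).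
rewrite -[X in principal_log X = _]/(val (z * r^-1 * r)%g) mulgKV => ->.
by rewrite inE /in_kernel bar_unit lD; case: (l _); case: (l _).
Qed.

Definition kernel_minus1 : {set {unit R}} := [set z | in_kernel (val z + 1)].

(** For d in the kernel, d z + 1 = d (z + 1/d) is in the kernel together with
    z + 1/d. *)
Lemma card_kernel_minus1_shift (d : {unit R}) : d \in kernel_units ->
  #|[set z in kernel_minus1 | (d * z \in kernel_minus1)%g]| =
  #|[set z | [&& bar z != 0, in_kernel (z + 1) & in_kernel (z + val d^-1%g)]]|.
Proof.
rewrite inE => dD.
pose P x := in_kernel (x + 1) && in_kernel (x + val d^-1%g).
rewrite -(card_unit_set P); apply: eq_card => z.
rewrite !inE /P; congr (_ && _).
have -> : val (d * z)%g + 1 = val d * (val z + val d^-1%g).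
  by rewrite mulrDr mulrV // (valP d).
have [z0|z0] := boolP (bar (val z + val d^-1%g) == 0).
  by rewrite /in_kernel rmorphM (eqP z0) mulr0 eqxx.
exact: in_kernelM.
Qed.

Section Family.
Variable N : {group {unit R}}.

Lemma card_coset_block_kernel i : N = kernel_units :> {set _} ->
  #|coset_block (N := N) kernel_minus1 i| = (2 ^ (n - 1) * (2 ^ (n - 1) - 1))%N.
Proof.
move=> ND; set r := repr (enum_val i).
rewrite (card_rcoset_slice _ r (mem kernel_minus1)).
pose P x :=
  (l (principal_log x) == l (principal_log (val r))) && in_kernel (x + 1).
rewrite (_ : [set z in _ | _] = [set z | P (val z)]); last first.
  by apply/setP=> z; rewrite !inE mem_rcoset ND kernel_coset.
apply/eqP; rewrite -(eqn_pmul2l (isT : (0 < 4)%N)) card_unit_set; apply/eqP.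
rewrite card_kernel_coset_shift.
by rewrite -{1 2}(subnK n_gt0) addn1 !expnS; nia.
Qed.

Hypothesis sND : N \subset kernel_units.

Lemma theta_in d : d \in (N :&: principal) :\ 1%g ->
  theta (@coset_block _ N kernel_minus1) d = (2 ^ n * (2 ^ (n - 2) - 1))%N.
Proof.
rewrite in_setD1 in_setI => /and3P[d1 Nd Ud]; have dD := subsetP sND d Nd.
rewrite theta_coset_block // card_kernel_minus1_shift //.
have [k dk] := principal_twice Ud.
have dV : d^-1%g = d.
  by apply/eqP; rewrite eq_invg_mul; apply/eqP/principal_sqr.
have k0 : k != 0.
  by apply: contra d1 => /eqP k0; apply/eqP/val_inj; rewrite dk k0 twice0 addr0.
have lk : ~~ l k.
  by move: dD; rewrite inE dk => /andP[_]; rewrite principal_log_1twice.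
apply/eqP; rewrite -(eqn_pmul2l (isT : (0 < 4)%N)) dV dk; apply/eqP.
rewrite card_kernel_principal_shifts //.
by rewrite -(subnK n_gt1) addnK expnD; lia.
Qed.

Lemma theta_out d : d \in N :\: (N :&: principal) ->
  theta (@coset_block _ N kernel_minus1) d
  = (2 ^ (n - 1) * (2 ^ (n - 1) - 1) - 2 ^ (n - 2))%N.
Proof.
rewrite !inE => /andP[+ Nd]; rewrite Nd /= => dU; have dD := subsetP sND d Nd.
rewrite theta_coset_block //; last first.
  by apply: contra dU => /eqP->; rewrite rmorph1.
rewrite card_kernel_minus1_shift //.
have dV1 : bar (val d^-1%g) != 1.
  apply: contra dU => /eqP dV; rewrite -[X in _ == X](rmorph1 bar).
  by rewrite -[in X in _ == X](mulrV (valP d)) rmorphM /= dV mulr1.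
apply/eqP; rewrite -(eqn_pmul2l (isT : (0 < 4)%N)); apply/eqP.
rewrite card_kernel_shifts ?bar_unit //.
have -> : (n - 1 = (n - 2).+1)%N by lia.
by rewrite -{1 2}(subnK n_gt1) addn2 !expnS; nia.
Qed.

Lemma coset_block_DDF : is_DDF N (N :&: principal)
  [seq #|coset_block (N := N) kernel_minus1 i|
    | i <- enum 'I_#|rcosets N [set: {unit R}]|]
  (2 ^ n * (2 ^ (n - 2) - 1)) (2 ^ (n - 1) * (2 ^ (n - 1) - 1) - 2 ^ (n - 2))
  (@coset_block _ N kernel_minus1).
Proof.
split=> //; try exact: groupP.
- by apply/centsP=> x _ y _; apply: mul_unitC.
- exact: subsetIl.
- by move=> i; apply/subsetP=> x; rewrite inE => /andP[].
- exact: theta_in.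
- exact: theta_out.
Qed.

End Family.

(** ** Polar decomposition of units *)

Section Structure.
Variable xi : R.
Hypotheses (xi_order : xi ^+ (2 ^ n - 1) = 1)
  (xi_gen : forall k : K, k != 0 ->
     exists2 i, (i < 2 ^ n - 1)%N & bar xi ^+ i = k).

Lemma units_card_gt0 : (0 < 2 ^ n - 1)%N.
Proof. by rewrite subn_gt0 -[1%N](expn0 2) ltn_exp2l. Qed.

Lemma xi_unit : xi \is a GRing.unit.
Proof. by rewrite -(unitrX_pos xi units_card_gt0) xi_order unitr1. Qed.

Lemma bar_xi_neq0 i : bar (xi ^+ i) != 0.
Proof. by rewrite -unit_bar unitrX ?xi_unit. Qed.

Lemma principal_log_polar i k : principal_log (xi ^+ i * (1 + twice k)) = k.
Proof.
rewrite principal_logM ?bar_xi_neq0 ?bar_1twice ?oner_neq0 // principal_log_1twice.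
by rewrite principal_log_root ?add0r // exprAC xi_order expr1n.
Qed.

Lemma unit_polar x : bar x != 0 ->
  exists2 i, (i < 2 ^ n - 1)%N & x = xi ^+ i * (1 + twice (principal_log x)).
Proof.
move=> x0; have [i lt_i xi_x] := xi_gen x0; exists i => //.
have [|k xk] := @bar_eqP x (xi ^+ i); first by rewrite rmorphXn /= xi_x.
suff x_eq : x = xi ^+ i * (1 + twice (k / bar (xi ^+ i))).
  by rewrite [in RHS]x_eq principal_log_polar.
by rewrite mulrDr mulr1 mul_twice mulrCA mulfV ?bar_xi_neq0 // mulr1.
Qed.

Definition unit_xi : {unit R} := FinRing.unit R xi_unit.

(** Reduction maps the powers of xi onto the q - 1 nonzero residues, so there are
    at least that many powers. *)
Lemma order_unit_xi : #[unit_xi]%g = (2 ^ n - 1)%N.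
Proof.
apply/eqP; rewrite eqn_leq dvdn_leq ?units_card_gt0 //=; last first.
  rewrite order_dvdn; apply/eqP/val_inj.
  by rewrite FinRing.val_unitX /= xi_order.
have -> : (2 ^ n - 1 = #|[set~ (0%R : K)]|)%N by rewrite cardsC1 cardK subn1.
apply: leq_trans (leq_imset_card (fun x : {unit R} => bar (val x)) _).
apply/subset_leq_card/subsetP=> k; rewrite !inE => /xi_gen[i _ <-].
apply/imsetP; exists (unit_xi ^+ i)%g; first exact: mem_cycle.
by rewrite FinRing.val_unitX rmorphXn.
Qed.

Lemma unit_xi_kernel : unit_xi \in kernel_units.
Proof.
by rewrite inE /in_kernel bar_unit /= principal_log_root // functional0.
Qed.

Lemma card_kernel_principal : #|kernel_units :&: principal| = (2 ^ (n - 1))%N.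
Proof.
have cardZ : #|[set k | l k == false]| = (2 ^ (n - 1))%N.
  apply/eqP; rewrite -(eqn_pmul2l (isT : (0 < 2)%N)) (card_functional _ lD) //.
  by rewrite cardK -expnS subn1 prednK.
rewrite -cardZ -(card_imset _ val_inj).
rewrite -(card_imset _ (inj_comp (addrI 1) twice_inj)).
apply: eq_card => x; apply/imsetP/imsetP=> [[y]|[k]].
  case/setIP=> + /principal_twice[k yk]; rewrite inE /in_kernel yk => /andP[_].
  rewrite principal_log_1twice => lk ->.
  by exists k; rewrite ?inE ?eqbF_neg //= yk.
rewrite inE eqbF_neg => lk -> /=.
have Ux : 1 + twice k \is a GRing.unit by rewrite unit_bar bar_1twice oner_neq0.
exists (FinRing.unit R Ux) => //.
by rewrite !inE /in_kernel /= bar_1twice eqxx oner_neq0 principal_log_1twice lk.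
Qed.

(** Dividing x by the power of xi in its residue class leaves a principal unit,
    and the orders q - 1 and q/2 of the factors are coprime. *)
Lemma kernel_dprod (N : {group {unit R}}) : N = kernel_units :> {set _} ->
  (<[unit_xi]> \x (N :&: principal) = N)%g.
Proof.
move=> ND; have cent (A B : {set {unit R}}) : A \subset 'C(B)%g.
  by apply/centsP=> x _ y _; apply: mul_unitC.
have Nxi : unit_xi \in N by rewrite ND unit_xi_kernel.
rewrite dprodE ?cent //=.
  apply/setP=> x; apply/mulsgP/idP=> [[y z /cycleP[i ->] /setIP[Nz _] ->]|Nx].
    by rewrite groupM ?groupX.
  have [i _ xi_x] := xi_gen (bar_unit x).
  exists (unit_xi ^+ i)%g ((unit_xi ^+ i)^-1 * x)%g;
    rewrite ?mem_cycle ?mulKVg //.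
  rewrite !inE groupM ?groupV ?groupX //= rmorphM /= -xi_x.
  rewrite rmorphV ?FinRing.val_unitX /= ?rmorphXn /= ?mulVf //.
    by rewrite xi_x bar_unit.
  exact: unitrX xi_unit.
have cardL : #|N :&: principal| = (2 ^ (n - 1))%N.
  by rewrite ND card_kernel_principal.
apply: coprime_TIg; rewrite -orderE order_unit_xi /= cardL.
by rewrite coprimeXr // coprimen2 oddB ?expn_gt0 // oddX orbF eqn0Ngt n_gt0.
Qed.

Lemma elementary_principal (N : {group {unit R}}) :
  (2.-abelem (N :&: principal))%g.
Proof.
apply/abelemP=> //; split; first by apply/centsP=> x _ y _; apply: mul_unitC.
by move=> x /setIP[_ /principal_sqr].
Qed.

(** The two decompositions have isomorphic factors.  Any resulting isomorphism
    respects the second factors, since these consist of the elements of square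
    1. *)
Lemma kernel_isom (N : {group {unit R}}) : N = kernel_units :> {set _} ->
  exists phi : {morphism N >-> target_group n},
    isom N [set: target_group n] phi /\
    phi @: (N :&: principal) = target_subgroup n.
Proof.
move=> ND; have dN := kernel_dprod ND.
have cardL : #|N :&: principal| = (2 ^ (n - 1))%N.
  by rewrite ND card_kernel_principal.
have isoC : <[unit_xi]>%g
    \isog setX [set: 'Z_(2 ^ n - 1)] [1 'rV['Z_2]_(n - 1)]%g.
  rewrite isog_cyclic_card ?cycle_cyclic //= cyclic_target.
  by rewrite card_target_cyclic // -orderE order_unit_xi eqxx.
have isoL : (N :&: principal) \isog target_subgroup n.
  rewrite (isog_abelem_card (setX_group _ _) (elementary_principal N)).
  by rewrite abelem_target_subgroup /= cardL card_target_subgroup.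
have [phi phiN] := isog_isom (isog_dprod dN (target_dprod n) isoC isoL).
exists phi; split=> //; have [injphi _] := isomP phiN.
apply/eqP; rewrite eqEcard card_target_subgroup.
rewrite card_in_imset ?cardL ?leqnn ?andbT; last first.
  by apply: sub_in2 (injmP injphi) => x /setIP[].
apply/subsetP=> _ /imsetP[x /setIP[Nx Ux] ->].
apply: mem_target_subgroup => //; by rewrite -morphX // principal_sqr // morph1.
Qed.

End Structure.
End Reduction.

(** * Reduction modulo 2 in GR(4, n) *)

Section GaloisRing.
Local Open Scope ring_scope.

Lemma red2_zmod_morphism : zmod_morphism red2.
Proof. by move=> [[|[|[|[|//]]]] ?] [[|[|[|[|//]]]] ?]; apply/val_inj. Qed.

Lemma red2_monoid_morphism : monoid_morphism red2.
Proof. by split=> [|[[|[|[|[|//]]]] ?] [[|[|[|[|//]]]] ?]]; apply/val_inj. Qed.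

HB.instance Definition _ := GRing.isZmodMorphism.Build 'Z_4 'F_2 red2
  red2_zmod_morphism.
HB.instance Definition _ := GRing.isMonoidMorphism.Build 'Z_4 'F_2 red2
  red2_monoid_morphism.

Definition Z4_half (c : 'Z_4) : 'Z_4 := (c./2)%:R.
Definition Z4_of_F2 (c : 'F_2) : 'Z_4 := (c : nat)%:R.

Lemma red2_eq0_Z4_half c : red2 c = 0 -> Z4_half c *+ 2 = c.
Proof. by case: c => [[|[|[|[|//]]]] ?] //; move/eqP => ?; apply/val_inj. Qed.

Lemma mulr2n_red2 c : c *+ 2 = 0 <-> red2 c = 0.
Proof.
by case: c => [[|[|[|[|//]]]] ?] //; split=> // /eqP // ?; apply/val_inj.
Qed.

Lemma Z4_of_F2K : cancel Z4_of_F2 red2.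
Proof. by case=> [[|[|//]] ?]; apply/val_inj. Qed.

Variables (n : nat) (g : {poly 'Z_4}).
Hypotheses (n_gt1 : (2 <= n)%N) (gP : primitive_basic_irreducible n g).

Let g_monic : g \is monic. Proof. by case: gP. Qed.
Let size_g : size g = n.+1. Proof. by case: gP. Qed.
Let h_primitive : primitive_poly (redp g). Proof. by case: gP. Qed.

Lemma size_redp : size (redp g) = n.+1.
Proof.
rewrite -size_g; apply: size_map_poly_id0.
by rewrite (monicP g_monic) rmorph1 oner_neq0.
Qed.

Local Notation R := (galois_ring g).
Local Notation K := {poly %/ redp g with primitive_mi h_primitive}.

Lemma mk_monic_g : mk_monic g = g.
Proof. by rewrite /mk_monic size_g g_monic ltnS (ltnW n_gt1). Qed.

Lemma mk_monic_redp : mk_monic (redp g) = redp g.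
Proof. exact/mk_monicE/primitive_mi. Qed.

(** The reduction [gr_bar], seen with values in the residue ring equipped with
    its field structure. *)
Definition reduction : R -> K := @gr_bar g.

Lemma reduction_zmod_morphism : zmod_morphism reduction.
Proof.
by move=> x y; rewrite /reduction /gr_bar /redp -rmorphB -rmorphB.
Qed.

(** Division by g reduces modulo 2 to a division by the reduction of g. *)
Lemma reduction_in_qpoly (p : {poly 'Z_4}) :
  reduction (in_qpoly g p) = in_qpoly (redp g) (redp p).
Proof.
rewrite /reduction /gr_bar /= mk_monic_g.
rewrite [in RHS](Pdiv.RingMonic.rdivp_eq g_monic p).
rewrite /redp rmorphD rmorphM /= -/(redp g) rmorphD rmorphM /=.
suff -> : in_qpoly (redp g) (redp g) = 0 by rewrite mulr0 add0r.
apply: val_inj; rewrite /= mk_monic_redp Pdiv.RingMonic.rmodpp //.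
exact: (primitive_mi h_primitive).2.
Qed.

Lemma reduction_monoid_morphism : monoid_morphism reduction.
Proof.
split=> [|x y].
  by rewrite -in_qpoly1 reduction_in_qpoly /redp rmorph1 in_qpoly1.
have -> : x * y = in_qpoly g (polyn x * polyn y) by [].
by rewrite reduction_in_qpoly /redp rmorphM /= in_qpolyM.
Qed.

HB.instance Definition _ := GRing.isZmodMorphism.Build R K reduction
  reduction_zmod_morphism.
HB.instance Definition _ := GRing.isMonoidMorphism.Build R K reduction
  reduction_monoid_morphism.

Lemma size_galois_ring (x : R) : (size (x : {poly %/ g}) <= n)%N.
Proof.
rewrite -ltnS; apply: leq_trans (size_mk_monic (x : {poly %/ g})) _.
by rewrite mk_monic_g size_g.
Qed.

Lemma poly_reduction (x : R) :
  (reduction x : {poly 'F_2}) = redp (x : {poly %/ g}).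
Proof.
rewrite /reduction /gr_bar in_qpoly_small // mk_monic_redp size_redp ltnS.
by apply: leq_trans (size_poly _ _) (size_galois_ring x).
Qed.

Lemma poly_galois_ring (p : {poly 'Z_4}) : (size p <= n)%N ->
  in_qpoly g p = p :> {poly 'Z_4}.
Proof. by move=> sz_p; rewrite in_qpoly_small // mk_monic_g size_g ltnS. Qed.

Lemma poly_mulrn (x : R) m :
  polyn (x *+ m) = polyn x *+ m :> {poly 'Z_4}.
Proof. by elim: m => [|m IHm]; rewrite ?mulr0n // !mulrS -IHm. Qed.

Lemma reduction_surj (k : K) : exists x : R, reduction x = k.
Proof.
have sz_k : (size (k : {poly %/ redp g}) <= n)%N.
  rewrite -ltnS; apply: leq_trans (size_mk_monic (k : {poly %/ redp g})) _.
  by rewrite mk_monic_redp size_redp.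
exists (in_qpoly g (\poly_(i < n) Z4_of_F2 (k : {poly %/ redp g})`_i)).
apply: val_inj; rewrite [LHS]poly_reduction poly_galois_ring ?size_poly //.
apply/polyP=> i; rewrite /redp coef_map /= coef_poly.
case: ltnP => [_|ni]; first by rewrite Z4_of_F2K.
by rewrite [in RHS]nth_default ?(leq_trans sz_k) // rmorph0.
Qed.

Lemma reduction_eq0P (x : R) : reduction x = 0 -> exists y : R, x = y *+ 2.
Proof.
move=> x0; have {}x0 i : red2 (x : {poly %/ g})`_i = 0.
  by rewrite -coef_map -/(redp _) -poly_reduction x0 coef0.
exists (in_qpoly g (\poly_(i < n) Z4_half (x : {poly %/ g})`_i)).
apply: val_inj; rewrite [RHS]poly_mulrn poly_galois_ring ?size_poly //.
apply/polyP=> i; rewrite coefMn coef_poly.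
case: ltnP => [_|ni]; first by rewrite red2_eq0_Z4_half.
by rewrite mul0rn nth_default // (leq_trans (size_galois_ring x)).
Qed.

Lemma reduction_mulr2n (x : R) : x *+ 2 = 0 <-> reduction x = 0.
Proof.
split=> x0.
  apply: val_inj; rewrite [LHS]poly_reduction; apply/polyP=> i.
  rewrite coef_map coef0; apply/mulr2n_red2; rewrite -coefMn.
  by rewrite -poly_mulrn x0 coef0.
apply: val_inj; rewrite [LHS]poly_mulrn; apply/polyP=> i.
rewrite coefMn coef0; apply/mulr2n_red2.
by rewrite -coef_map -/(redp _) -poly_reduction x0 coef0.
Qed.

Lemma galois_ring_reduction : galois_reduction reduction.
Proof.
split; [exact: reduction_surj | exact: reduction_eq0P | exact: reduction_mulr2n].
Qed.

Lemma card_residue : #|K| = (2 ^ n)%N.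
Proof. by rewrite card_qfpoly size_redp card_ord. Qed.

Lemma reduction_xi_gen (k : K) : k != 0 ->
  exists2 i, (i < 2 ^ n - 1)%N & reduction (gr_xi g) ^+ i = k.
Proof.
move=> k0; have sz : (2 < size (redp g))%N by rewrite size_redp.
exists (qlogp k); first by have := qlogp_lt k; rewrite card_residue subn1.
have -> : reduction (gr_xi g) = 'qX.
  by rewrite reduction_in_qpoly /redp map_polyX.
exact: (qlogp_qX sz k0).
Qed.

Lemma gr_xi_order : gr_xi g ^+ (2 ^ n - 1) = 1.
Proof. by case: gP. Qed.

Lemma teichmuller_lift (k : K) :
  exists2 b, b \in teichmuller n g & reduction b = k.
Proof.
have [->|k0] := eqVneq k 0; first by exists 0; rewrite ?rmorph0 ?setU11.
have [i lt_i <-] := reduction_xi_gen k0.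
exists (gr_xi g ^+ i); last by rewrite rmorphXn.
by rewrite inE orbC; apply/orP; left; apply/imsetP; exists (Ordinal lt_i).
Qed.

Lemma mul2_twice (b : R) : 2 * b = twice reduction (reduction b).
Proof. by rewrite (twice_bar galois_ring_reduction) mulr_natl. Qed.

Lemma principal_unitsE : principal_units n g = principal reduction.
Proof.
apply/setP=> x; rewrite !inE; apply/exists_inP/eqP=> [[b _ /eqP->]|x1].
  by rewrite mul2_twice (bar_1twice galois_ring_reduction card_residue).
have [|k xk] := @bar_eqP _ _ _ galois_ring_reduction (val x) 1.
  by rewrite x1 rmorph1.
have [b Tb bk] := teichmuller_lift k; exists b => //.
by rewrite mul2_twice bk xk.
Qed.

Variable u : residue_field g.
Hypothesis u_neq0 : u != 0.

Definition trace_bit (k : K) : bool := abs_trace n (u * k) != 0.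

Lemma trace_bitD : {morph trace_bit : x y / x + y >-> x (+) y}.
Proof.
move=> x y; rewrite /trace_bit mulrDr.
exact: (@trace_neq0D n K (ltnW n_gt1) card_residue).
Qed.

Lemma trace_bit_nonzero : exists k, trace_bit k.
Proof.
have [t tr_t] := @trace_nonzero n K (ltnW n_gt1) card_residue.
exists ((u : K)^-1 * t); rewrite /trace_bit.
suff -> : u * ((u : K)^-1 * t) = t by [].
by rewrite (mulVKf (u_neq0 : (u : K) != 0)).
Qed.

(** The decomposition x = a (1 + 2b) that defines D exhibits b as the principal
    logarithm of x. *)
Lemma index2_unitsE : index2_units n u = kernel_units reduction n trace_bit.
Proof.
have barR := galois_ring_reduction; have cardK := card_residue.
have xi_gen := reduction_xi_gen; have n_gt0 := ltnW n_gt1.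
apply/setP=> x; rewrite !inE; apply/exists_inP/andP.
  case=> a /setD1P[a0 /setU1P[/eqP|/imsetP[i _ a_xi]]].
    by rewrite (negPf a0).
  case/exists_inP=> b Tb /andP[]; rewrite inE => tr_b /eqP x_eq.
  rewrite (bar_unit barR cardK) x_eq a_xi mul2_twice; split=> //.
  rewrite (principal_log_polar barR n_gt1 cardK gr_xi_order).
  by rewrite /trace_bit negbK.
case=> x0 lx.
have [i lt_i x_eq] := unit_polar barR n_gt1 cardK gr_xi_order xi_gen x0.
have [b Tb bk] := teichmuller_lift (principal_log reduction n (val x)).
exists (gr_xi g ^+ i).
  rewrite !inE; apply/andP; split.
    apply/eqP=> xi0; have := bar_xi_neq0 barR n_gt1 cardK gr_xi_order i.
    by rewrite xi0 rmorph0 eqxx.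
  by apply/orP; right; apply/imsetP; exists (Ordinal lt_i).
apply/exists_inP; exists b => //; rewrite inE mul2_twice bk -x_eq eqxx andbT.
have -> : gr_bar b = principal_log reduction n (val x) by [].
by move: lx; rewrite /trace_bit negbK.
Qed.

End GaloisRing.

(** * The divisible difference family *)

Theorem theorem3p1 (n : nat) (hn : (2 <= n)%N) (g : {poly 'Z_4})
    (hg : primitive_basic_irreducible n g)
    (u : residue_field g) (hu0 : u != 0%R) (hu : abs_trace n u = 0%R)
    (N : {group {unit (galois_ring g)}}) (hN : N \subset index2_units n u) :
  let L := N :&: principal_units n g in
  let lambda := (2 ^ n * (2 ^ (n - 2) - 1))%N in
  let mu := (2 ^ (n - 1) * (2 ^ (n - 1) - 1) - 2 ^ (n - 2))%N in
  let k := (2 ^ (n - 1) * (2 ^ (n - 1) - 1))%N in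
  exists (b : nat) (F : 'I_b -> {set {unit (galois_ring g)}}) (K : seq nat),
    is_DDF N L K lambda mu F /\
    (N = index2_units n u :> {set _} ->
      exists phi : {morphism N >-> target_group n},
        [/\ isom N [set: target_group n] phi,
            phi @: L = target_subgroup n
          & is_DDF [set: target_group n] (target_subgroup n)
              (nseq b k) lambda mu (fun i => phi @: F i)]).
Proof.
rewrite (principal_unitsE hn hg) (index2_unitsE hn hg) in hN *.
move=> L lambda mu k.
have barR := galois_ring_reduction hn hg; have cardK := card_residue hg.
have lD := trace_bitD hn (gP := hg) u.
have l_nonzero := trace_bit_nonzero hn hg hu0.
have ddf := coset_block_DDF barR hn cardK lD l_nonzero hN.
set F := coset_block _ in ddf.
exists _, F, [seq #|F i| | i <- enum 'I_#|rcosets N setT|].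
split=> [|ND]; first exact: ddf.
have [phi [phiN phiL]] := kernel_isom barR hn cardK lD l_nonzero
  (gr_xi_order hg) (@reduction_xi_gen n g hn hg) ND.
exists phi; split=> //; have [injphi imphi] := isomP phiN.
move: (DDF_injm injphi ddf); rewrite phiL -morphimEdom imphi.
set sizes := [seq _ | i <- _]; suff -> : sizes = nseq #|rcosets N setT| k by [].
have <- : size sizes = #|rcosets N setT| by rewrite size_map size_enum_ord.
apply/all_pred1P/allP=> _ /mapP[i _ ->] /=; apply/eqP.
exact: card_coset_block_kernel.
Qed.
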